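(* Let $0\le\lambda\le 1$ and $\mu\ge 0$. Let $q^{[1]}\in\mathcal{P}(\mathcal{X}\times\mathcal{Y})$ be any probability distribution all of whose components are nonzero, and for $t=1,2,3,\ldots$ define $$q^{[t+1]}(x,y)=\frac{\exp\{-\omega^{(\mu,\lambda)}_{q^{[t]}}(x,y)\}\,q^{[t]}(x,y)}{\Lambda^{(\mu,\lambda)}_{q^{[t]}}},\qquad \Lambda^{(\mu,\lambda)}_{q^{[t]}}=\mathrm{E}_{q^{[t]}}\big[\exp\{-\omega^{(\mu,\lambda)}_{q^{[t]}}(X,Y)\}\big].$$ Then, as $t\to\infty$, the sequence $q^{[t]}$ converges to an optimal distribution $q^*\in\mathcal{P}(\mathcal{X}\times\mathcal{Y})$, i.e. one attaining the minimum over $q\in\mathcal{P}(\mathcal{X}\times\mathcal{Y})$ of $$\mathrm{E}_q\big[\omega^{(\mu,\lambda)}_q(X,Y)\big]=\lambda I(q_X,q_{Y|X})+D(q_X\|P)+\mu\,\mathrm{E}_q[d(X,Y)].$$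
   Context: $\mathcal{X},\mathcal{Y}$ are finite sets, $P$ is a probability distribution on $\mathcal{X}$, and $d:\mathcal{X}\times\mathcal{Y}\to[0,\infty)$ is a distortion measure such that for every $x\in\mathcal{X}$ there is $y\in\mathcal{Y}$ with $d(x,y)=0$. $\mathcal{P}(\mathcal{X}\times\mathcal{Y})$ is the set of probability distributions on $\mathcal{X}\times\mathcal{Y}$. For $q\in\mathcal{P}(\mathcal{X}\times\mathcal{Y})$, $q_X,q_Y$ are its marginals, $q_{Y|X},q_{X|Y}$ its conditionals, $\mathrm{E}_q$ is expectation for $(X,Y)\sim q$ (a sum over the support of $q$), $I(q_X,q_{Y|X})$ is the mutual information of $(X,Y)\sim q$, and $D(\cdot\|\cdot)$ is Kullback–Leibler divergence (value $+\infty$ allowed). Logarithms are natural. For $q\in\mathcal{P}(\mathcal{X}\times\mathcal{Y})$, $$\omega^{(\mu,\lambda)}_q(x,y)=\log\frac{q_X(x)^{1-\lambda}\,q_{X|Y}(x|y)^{\lambda}\,\exp(\mu d(x,y))}{P(x)}$$ for $(x,y)$ with $q(x,y)>0$ (equal to $+\infty$, with $\exp(-\infty)=0$, if $P(x)=0$); in the update, $q^{[t+1]}(x,y)=0$ whenever $q^{[t]}(x,y)=0$. The minimum of $\mathrm{E}_q[\omega_q^{(\mu,\lambda)}(X,Y)]$ over $q$ is denoted $\Omega^{(\mu,\lambda)}(P)$. *)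

(* Defs.v *)
From mathcomp Require Import all_boot all_order all_algebra.
From mathcomp Require Import all_classical all_reals all_analysis.

Set Implicit Arguments.
Unset Strict Implicit.
Unset Printing Implicit Defensive.

Import Order.TTheory GRing.Theory Num.Theory.
Import numFieldNormedType.Exports.

Local Open Scope ring_scope.

Definition is_dist (R : realType) (T : finType) (p : T -> R) : Prop :=
  (forall a, 0 <= p a) /\ \sum_(a : T) p a = 1.

(* The sum ranges over the support of [p] only, so the values of [f] outside it,
   possibly infinite, are irrelevant. *)
Definition expect (R : realType) (T : finType) (p : T -> R) (f : T -> \bar R) :
    \bar R :=
  (\sum_(a : T | p a != 0%R) (p a)%:E * f a)%E.

Definition KL (R : realType) (T : finType) (p r : T -> R) : \bar R :=
  expect p (fun a => if r a == 0 then +oo%E else (ln (p a / r a))%:E).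

Section JointLaw.
Variables (R : realType) (X Y : finType).
Implicit Types (q : X * Y -> R) (z : X * Y).

Definition margX q (x : X) : R := \sum_(y : Y) q (x, y).

Definition margY q (y : Y) : R := \sum_(x : X) q (x, y).

Definition condXY q (x : X) (y : Y) : R := q (x, y) / margY q y.

Definition mutual_info q : \bar R :=
  KL q (fun z => margX q z.1 * margY q z.2).

Variables (P : X -> R) (d : X * Y -> R) (mu lambda : R).

(* Only meaningful where [q z != 0]: both powers then have positive bases. *)
Definition omega q z : \bar R :=
  if P z.1 == 0 then +oo%E
  else (ln (margX q z.1 `^ (1 - lambda) * condXY q z.1 z.2 `^ lambda
            * expR (mu * d z) / P z.1))%:E.

Definition Lambda q : \bar R := expect q (fun z => expeR (- omega q z)%E).

(* [omega] is never [-oo], so both arguments of [fine] are finite. *)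
Definition update q z : R :=
  if q z == 0 then 0
  else fine (expeR (- omega q z)%E) * q z / fine (Lambda q).

Definition objective q : \bar R := expect q (omega q).

Definition is_optimal q : Prop :=
  is_dist q /\ forall q', is_dist q' -> (objective q <= objective q')%E.

End JointLaw.

(* Main.v *)
Require Import Defs.
From mathcomp Require Import all_boot all_order all_algebra.
From mathcomp Require Import all_classical all_reals all_analysis.
From mathcomp Require Import ring lra.
Import Order.TTheory GRing.Theory Num.Theory.
Import numFieldNormedType.Exports.
Local Open Scope classical_set_scope.
Local Open Scope ring_scope.

(* Write w_q for omega_q, F(q) = E_q[w_q] and l(q) = - log Lambda_q, and let q' be
   the update of q. Two identities drive the argument:
     F(p) - E_p[w_q] = (1-lambda) D(p_X||q_X) + lambda (D(p||q) - D(p_Y||q_Y)),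
     D(p||q) - D(p||q') = l(q) - E_p[w_q].
   By the data processing inequality the first right-hand side lies between 0 and
   D(p||q). Hence D(p||q) - D(p||q') >= l(q) - F(p) for every p, and
   F(q') <= E_q'[w_q] + D(q'||q) = l(q), while l(q') <= F(q').
   Let s be the limit of the iterates along an ultrafilter finer than the one at
   infinity. F is continuous, so F(s) <= l(q^[t]) for all t; telescoping the first
   inequality then bounds n (F(s) - F(p)) by D(p||q^[2]) for all n, so s is optimal.
   Taking p = s, D(s||q^[t]) is nonincreasing, and it tends to 0 along the
   ultrafilter, hence along the whole sequence; it dominates the squared Hellinger
   distance, so q^[t] converges to s.
   From t = 2 on, the support of q^[t] is {P > 0}, so everything but the comparison
   with arbitrary distributions takes place among real numbers. *)

Set Implicit Arguments.
Unset Strict Implicit.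

(** * Gibbs' inequality and the Hellinger bound for finite laws *)

Section RelativeEntropy.
Variable R : realType.

(** A difference of logarithms rather than the logarithm of a ratio: with the total [ln], the
    identities below then hold by [ring], without positivity conditions. *)
Definition rel_entropy (T : finType) (p r : T -> R) : R :=
  \sum_(a : T) p a * (ln (p a) - ln (r a)).

Lemma ln_le_subr1 (x : R) : 0 < x -> ln x <= x - 1.
Proof.
move=> x0; have := @le_ln1Dx R (x - 1); rewrite addrCA subrr addr0; apply.
by rewrite ltrBrDr addNr.
Qed.

Lemma ln_divr (x y : R) : 0 < x -> 0 < y -> ln (x / y) = ln x - ln y.
Proof. by move=> x0 y0; rewrite lnM ?lnV ?posrE ?invr_gt0. Qed.

Lemma subr_le_mul_ln (p r : R) : 0 <= p -> 0 <= r -> (r = 0 -> p = 0) ->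
  p - r <= p * (ln p - ln r).
Proof.
rewrite le_eqVlt => /predU1P[<-|p0] r0 rp; first by rewrite mul0r sub0r oppr_le0.
have {}r0 : 0 < r.
  by rewrite lt_def r0 andbT; apply/eqP => /rp p_eq0; rewrite p_eq0 ltxx in p0.
have := @ln_le_subr1 (r / p) (divr_gt0 r0 p0); rewrite ln_divr// => h.
rewrite -lerN2 opprB -mulrN opprB; apply: (le_trans (ler_wpM2l (ltW p0) h)).
by rewrite mulrBr mulr1 mulrCA divff ?mulr1// gt_eqF.
Qed.

(** Total masses are left free because the data processing inequality applies this to a measure not
    known to be normalized. *)
Lemma rel_entropy_ge (T : finType) (p r : T -> R) :
  (forall a, 0 <= p a) -> (forall a, 0 <= r a) -> (forall a, r a = 0 -> p a = 0) ->
  \sum_a p a - \sum_a r a <= rel_entropy p r.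
Proof.
move=> p0 r0 rp; rewrite -sumrB; apply: ler_sum => a _.
by apply: subr_le_mul_ln => //; apply: rp.
Qed.

Lemma rel_entropy_ge0 (T : finType) (p r : T -> R) :
  is_dist p -> is_dist r -> (forall a, r a = 0 -> p a = 0) -> 0 <= rel_entropy p r.
Proof.
move=> [p0 p1] [r0 r1] rp; apply: (le_trans _ (rel_entropy_ge p0 r0 rp)).
by rewrite p1 r1 subrr.
Qed.

(** For laws the left side is 2 (1 - sum of sqrt (p r)); then [ln x <= x - 1] is applied termwise at
    x = sqrt (r / p). *)
Lemma hellinger_le_rel_entropy (T : finType) (p r : T -> R) :
  is_dist p -> is_dist r -> (forall a, r a = 0 -> p a = 0) ->
  \sum_a (Num.sqrt (p a) - Num.sqrt (r a)) ^+ 2 <= rel_entropy p r.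
Proof.
move=> [p0 p1] [r0 r1] rp.
have -> : \sum_a (Num.sqrt (p a) - Num.sqrt (r a)) ^+ 2 =
    \sum_a 2 * (p a - Num.sqrt (p a) * Num.sqrt (r a)).
  (* The added terms [r a - p a] sum to 0. *)
  transitivity (\sum_a (2 * (p a - Num.sqrt (p a) * Num.sqrt (r a)) + (r a - p a))).
    apply: eq_bigr => a _; rewrite sqrrB !sqr_sqrtr//; ring.
  by rewrite big_split /= sumrB p1 r1 subrr addr0.
apply: ler_sum => a _.
have [pa0|pa0] := eqVneq (p a) 0; first by rewrite pa0 sqrtr0 !mul0r subrr mulr0.
have ra0 : r a != 0 by apply: contra_neq pa0 => /rp.
have pp : 0 < p a by rewrite lt_def pa0 p0.
have rr : 0 < r a by rewrite lt_def ra0 r0.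
have := @ln_le_subr1 (Num.sqrt (r a) / Num.sqrt (p a)).
rewrite divr_gt0 ?sqrtr_gt0// ln_divr ?sqrtr_gt0// => /(_ isT) h.
have lnsq (x : R) : 0 < x -> ln x = 2 * ln (Num.sqrt x).
  by move=> x0; rewrite -{1}(sqr_sqrtr (ltW x0)) expr2 lnM ?posrE ?sqrtr_gt0//; ring.
rewrite (lnsq _ pp) (lnsq _ rr).
have := ler_wpM2l (ltW pp) h.
have -> : p a * (Num.sqrt (r a) / Num.sqrt (p a) - 1) =
    Num.sqrt (p a) * Num.sqrt (r a) - p a.
  rewrite -{1 4}(sqr_sqrtr (ltW pp)); field.
  by rewrite gt_eqF ?sqrtr_gt0.
lra.
Qed.

(** Factor p - r as (sqrt p - sqrt r)(sqrt p + sqrt r); the second factor is at most 2, whence the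
    constant 4. *)
Lemma sqr_dist_le_rel_entropy (T : finType) (p r : T -> R) (a : T) :
  is_dist p -> is_dist r -> (forall a, r a = 0 -> p a = 0) ->
  (p a - r a) ^+ 2 <= 4 * rel_entropy p r.
Proof.
move=> pd rd rp; have := hellinger_le_rel_entropy pd rd rp.
have sqrt_le1 (s : T -> R) : is_dist s -> 0 <= Num.sqrt (s a) <= 1.
  move=> [s0 s1]; rewrite sqrtr_ge0 -[leRHS]sqrtr1 ler_psqrt ?nnegrE//.
  by rewrite -s1 (bigD1 a)//= lerDl; apply: sumr_ge0.
have /andP[sp0 sp1] := sqrt_le1 _ pd; have /andP[sr0 sr1] := sqrt_le1 _ rd.
rewrite (bigD1 a)//= -(ler_pM2l (_ : 0 < 4))// mulrDr => /(le_trans _); apply.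
rewrite -[leLHS]addr0 lerD//; last by rewrite mulr_ge0// sumr_ge0// => b _; apply: sqr_ge0.
case: pd rd => [p0 _] [r0 _].
rewrite -{1}(sqr_sqrtr (p0 a)) -{1}(sqr_sqrtr (r0 a)) subr_sqr exprMn mulrC.
by rewrite ler_wpM2r ?sqr_ge0// -[leRHS](_ : 2 ^+ 2 = 4) ?ler_pXn2r ?nnegrE ?addr_ge0//;
  [lra|ring].
Qed.

(** * Image measures and the data processing inequality *)

Definition pushforward (A B : finType) (f : A -> B) (p : A -> R) (b : B) : R :=
  \sum_(a | f a == b) p a.

Section Pushforward.
Variables (A B : finType) (f : A -> B).
Implicit Types p r : A -> R.

Lemma sum_pushforwardM p (g : B -> R) :
  \sum_b pushforward f p b * g b = \sum_a p a * g (f a).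
Proof.
rewrite [RHS](partition_big f xpredT)//=; apply: eq_bigr => b _.
by rewrite mulr_suml; apply: eq_bigr => a /eqP ->.
Qed.

Lemma sum_pushforward p : \sum_b pushforward f p b = \sum_a p a.
Proof.
have := sum_pushforwardM p (fun=> 1).
by under eq_bigr do rewrite mulr1; under [X in _ = X]eq_bigr do rewrite mulr1.
Qed.

Lemma pushforward_ge0 p b : (forall a, 0 <= p a) -> 0 <= pushforward f p b.
Proof. by move=> p0; apply: sumr_ge0. Qed.

Lemma le_pushforward p a : (forall a, 0 <= p a) -> p a <= pushforward f p (f a).
Proof.
by move=> p0; rewrite /pushforward (bigD1 a)//= lerDl; apply: sumr_ge0.
Qed.

Lemma pushforward_is_dist p : is_dist p -> is_dist (pushforward f p).
Proof.
move=> [p0 p1]; split; last by rewrite sum_pushforward.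
by move=> b; apply: pushforward_ge0.
Qed.

Lemma pushforward_eq0 p r : (forall a, 0 <= r a) -> (forall a, r a = 0 -> p a = 0) ->
  forall b, pushforward f r b = 0 -> pushforward f p b = 0.
Proof.
move=> r0 rp b rb0; apply: big1 => a /eqP fa; apply: rp.
by apply/eqP; rewrite eq_le r0 andbT -rb0 -fa le_pushforward.
Qed.

(* Gibbs' inequality for [p] against [r a * p' (f a) / r' (f a)], where [p'] and
   [r'] are the images of [p] and [r]: this measure has the same image as [p]. *)
Lemma rel_entropy_pushforward p r :
  (forall a, 0 <= p a) -> (forall a, 0 <= r a) -> (forall a, r a = 0 -> p a = 0) ->
  rel_entropy (pushforward f p) (pushforward f r) <= rel_entropy p r.
Proof.
move=> p0 r0 rp.
pose p' := pushforward f p; pose r' := pushforward f r.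
pose s a := r a * (p' (f a) / r' (f a)).
have pp' a : p a != 0 -> 0 < p' (f a).
  by move=> pa; apply: (lt_le_trans _ (le_pushforward a p0)); rewrite lt_def pa p0.
have rr' a : p a != 0 -> 0 < r a /\ 0 < r' (f a).
  move=> pa; have ra : 0 < r a.
    by rewrite lt_def r0 andbT; apply: contra_neq pa => /rp.
  by split => //; apply: (lt_le_trans ra); apply: le_pushforward.
have s0 a : 0 <= s a.
  by rewrite mulr_ge0// divr_ge0//; apply: pushforward_ge0.
have sp a : s a = 0 -> p a = 0.
  move=> sa; apply/eqP; apply/negPn/negP => pa.
  have [ra r'a] := rr' _ pa; have p'a := pp' _ pa.
  by have := mulr_gt0 ra (divr_gt0 p'a r'a); rewrite -/(s a) sa ltxx.
rewrite -subr_ge0; suff -> : rel_entropy p r - rel_entropy p' r' = rel_entropy p s.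
  apply: le_trans (rel_entropy_ge p0 s0 sp); rewrite subr_ge0.
  (* Summed over fibres, the mass of [s] is that of [p'] on the points where [r'] is nonzero, hence
     at most that of [p]. *)
  rewrite -(sum_pushforwardM r (fun b => p' b / r' b)) -(sum_pushforward p).
  apply: ler_sum => b _; rewrite -/(r' b) -/(p' b) mulrCA.
  have [->|?] := eqVneq (r' b) 0; last by rewrite divff// mulr1.
  by rewrite mul0r mulr0; apply: pushforward_ge0.
rewrite /rel_entropy sum_pushforwardM -sumrB; apply: eq_bigr => a _.
have [->|pa] := eqVneq (p a) 0; first by rewrite !mul0r subrr.
have [ra r'a] := rr' _ pa; have p'a := pp' _ pa.
rewrite /s lnM ?posrE ?divr_gt0// ln_divr//; rewrite /p' /r'; ring.
Qed.

End Pushforward.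

End RelativeEntropy.

(** * The objective among real numbers and its linearization at a law *)

Section RateDistortion.
Variables (R : realType) (X Y : finType) (P : X -> R) (d : X * Y -> R).
Variables (mu lambda : R).
Hypotheses (lambda_ge0 : 0 <= lambda) (lambda_le1 : lambda <= 1).
Implicit Types (p q r : X * Y -> R) (z : X * Y).

Lemma margXE q : margX q = pushforward fst q.
Proof.
apply/funext => x; rewrite /margX /pushforward.
rewrite (eq_bigl (fun z => (z.1 == x) && true)); last by move=> z; rewrite andbT.
rewrite (eq_bigr (fun a => q (a.1, a.2))); last by case.
by rewrite -(pair_big (fun i => i == x) xpredT (fun i j => q (i, j)))/= big_pred1_eq.
Qed.

Lemma margYE q : margY q = pushforward snd q.
Proof.
apply/funext => y; rewrite /margY /pushforward.
rewrite (eq_bigr (fun a => q (a.1, a.2))); last by case.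
rewrite -(pair_big xpredT (fun j => j == y) (fun i j => q (i, j)))/=.
by apply: eq_bigr => x _; rewrite big_pred1_eq.
Qed.

(* The real-valued [omega], for [q z] and [P z.1] nonzero. Elsewhere it is junk,
   with [ln 0 = 0], and only occurs multiplied by [q z] or [p z] equal to 0. *)
Definition weight q z : R :=
  (1 - lambda) * ln (margX q z.1) + lambda * (ln (q z) - ln (margY q z.2))
  + mu * d z - ln (P z.1).

Definition energy q : R := \sum_z q z * weight q z.

Lemma energy_sub_weight p r :
  energy p - \sum_z p z * weight r z =
  (1 - lambda) * rel_entropy (margX p) (margX r)
  + lambda * (rel_entropy p r - rel_entropy (margY p) (margY r)).
Proof.
rewrite !margXE !margYE /rel_entropy !sum_pushforwardM -!sumrB !mulr_sumr -big_split /=.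
by apply: eq_bigr => z _; rewrite /weight !margXE !margYE; ring.
Qed.

(** Both terms of [energy_sub_weight] are nonnegative: the first by Gibbs, the second by data
    processing for the Y-marginal. *)
Lemma le_energy p r : is_dist p -> is_dist r -> (forall z, r z = 0 -> p z = 0) ->
  \sum_z p z * weight r z <= energy p.
Proof.
move=> pd rd rp; rewrite -subr_ge0 energy_sub_weight !margXE !margYE.
rewrite addr_ge0// mulr_ge0// ?subr_ge0//; last first.
  by apply: rel_entropy_pushforward => //; [apply: pd.1|apply: rd.1].
apply: rel_entropy_ge0; [exact: pushforward_is_dist..|].
by apply: pushforward_eq0 => //; apply: rd.1.
Qed.

(** Data processing bounds the X-term by [rel_entropy p r], the Y-term is dropped by Gibbs, and the
    coefficients 1 - lambda and lambda add up to 1. *)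
Lemma energy_le p r : is_dist p -> is_dist r -> (forall z, r z = 0 -> p z = 0) ->
  energy p <= \sum_z p z * weight r z + rel_entropy p r.
Proof.
move=> pd rd rp; rewrite -lerBlDl energy_sub_weight.
have DX : rel_entropy (margX p) (margX r) <= rel_entropy p r.
  by rewrite !margXE; apply: rel_entropy_pushforward => //; [apply: pd.1|apply: rd.1].
have DY : 0 <= rel_entropy (margY p) (margY r).
  rewrite !margYE; apply: rel_entropy_ge0; [exact: pushforward_is_dist..|].
  by apply: pushforward_eq0 => //; apply: rd.1.
have := ler_wpM2l lambda_ge0 DY.
have : 0 <= 1 - lambda by rewrite subr_ge0.
move=> /ler_wpM2l /(_ _ _ DX); lra.
Qed.


(** * One update step and its descent inequalities *)

(** The real value of [Lambda] once [q] vanishes wherever [P] does. *)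
Definition normalizer q : R := \sum_z q z * expR (- weight q z).

Definition step q z : R := q z * expR (- weight q z) / normalizer q.

Lemma normalizer_gt0 q : is_dist q -> 0 < normalizer q.
Proof.
move=> [q0 q1]; rewrite lt_def sumr_ge0 ?andbT//; last first.
  by move=> z _; rewrite mulr_ge0// expR_ge0.
apply/eqP => /psumr_eq0P => /(_ (fun z _ => mulr_ge0 (q0 z) (expR_ge0 _))) qz.
suff : \sum_z q z = 0 by rewrite q1; apply/eqP/oner_neq0.
apply: big1 => z _; have /eqP := qz z isT.
by rewrite mulf_eq0 (gt_eqF (expR_gt0 _)) orbF => /eqP.
Qed.

Lemma step_eq0 q z : is_dist q -> (step q z == 0) = (q z == 0).
Proof.
move=> qd; rewrite /step !mulf_eq0 invr_eq0 (gt_eqF (expR_gt0 _)) (gt_eqF (normalizer_gt0 qd)).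
by rewrite !orbF.
Qed.

Lemma step_is_dist q : is_dist q -> is_dist (step q).
Proof.
move=> qd; have Z0 := normalizer_gt0 qd; split=> [z|].
  by rewrite divr_ge0 ?(ltW Z0)// mulr_ge0 ?expR_ge0//; case: qd.
by rewrite -mulr_suml -/(normalizer q) divff// gt_eqF.
Qed.

Lemma ln_step q z : is_dist q -> q z != 0 ->
  ln (step q z) = ln (q z) - weight q z - ln (normalizer q).
Proof.
move=> qd qz; have Z0 := normalizer_gt0 qd.
have q0 : 0 < q z by rewrite lt_def qz qd.1.
by rewrite /step ln_divr ?mulr_gt0 ?expR_gt0// lnM ?posrE ?expR_gt0// expRK.
Qed.

(** By [ln_step], weight plus log-ratio of [step q] to [q] is the constant [- ln (normalizer q)] on
    the support of [q]. *)
Lemma energy_step q : is_dist q -> energy (step q) <= - ln (normalizer q).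
Proof.
move=> qd; have sd := step_is_dist qd.
apply: (le_trans (energy_le sd qd _)) => [z qz|].
  by apply/eqP; rewrite step_eq0// qz.
have -> : - ln (normalizer q) = \sum_z step q z * (- ln (normalizer q)).
  by rewrite -mulr_suml sd.2 mul1r.
rewrite /rel_entropy -big_split/=; apply: ler_sum => z _.
have [qz|qz] := eqVneq (q z) 0.
  by have /eqP -> : step q z == 0 by [rewrite step_eq0// qz]; rewrite !mul0r addr0.
by rewrite ln_step//; rewrite le_eqVlt; apply/orP; left; apply/eqP; ring.
Qed.

Lemma rel_entropy_step p q : is_dist p -> is_dist q -> (forall z, q z = 0 -> p z = 0) ->
  - ln (normalizer q) - energy p <= rel_entropy p q - rel_entropy p (step q).
Proof.
move=> pd qd qp; apply: (@le_trans _ _ (- ln (normalizer q) - \sum_z p z * weight q z)).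
  by rewrite lerD2l lerN2; apply: le_energy.
have -> : - ln (normalizer q) = \sum_z p z * (- ln (normalizer q)).
  by rewrite -mulr_suml pd.2 mul1r.
rewrite /rel_entropy -!sumrB; apply: ler_sum => z _.
have [pz|pz] := eqVneq (p z) 0; first by rewrite pz !mul0r subrr.
rewrite ln_step//; first by rewrite le_eqVlt; apply/orP; left; apply/eqP; ring.
by apply: contra_neq pz => /qp.
Qed.

Lemma ln_normalizer_le_energy q : is_dist q -> - ln (normalizer q) <= energy q.
Proof.
move=> qd; have := rel_entropy_step qd qd (fun=> id).
have -> : rel_entropy q q = 0 by apply: big1 => z _; rewrite subrr mulr0.
have : 0 <= rel_entropy q (step q).
  apply: rel_entropy_ge0 => // [|z /eqP]; first exact: step_is_dist.
  by rewrite step_eq0// => /eqP.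
lra.
Qed.


(** * Continuity of the objective and limits along filters *)

Lemma cvg_sumr (T : Type) (F : set_system T) {FF : Filter F} (I : finType)
    (f : I -> T -> R) (l : I -> R) :
  (forall i, f i t @[t --> F] --> l i) ->
  \sum_i f i t @[t --> F] --> \sum_i l i.
Proof. by move=> fl; apply: cvg_big => // x; apply: add_continuous. Qed.

Lemma continuous_mul_ln : continuous (fun x : R => x * ln x).
Proof.
move=> x; have [x0|x0|->] := ltgtP x 0.
(* For negative x the function is locally 0, since [ln] is 0 on nonpositive reals. *)
- apply: (@near_cst_continuous _ _ 0); near=> y.
  by rewrite ln0 ?mulr0//; apply: ltW; near: y; apply: lt_nbhsl.
- by apply: cvgM; [exact: cvg_id|exact: continuous_ln].
rewrite /continuous_at mul0r.
(* At 0 the squeeze is - 2 sqrt y <= y ln y <= y (y - 1), valid on both sides of 0. *)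
have sqrt0 : - (2 * Num.sqrt y) @[y --> (0 : R)] --> (0 : R).
  rewrite -[X in _ --> X](_ : - (2 * Num.sqrt (0 : R)) = 0).
    by apply: cvgN; apply: cvgM; [exact: cvg_cst|exact: sqrt_continuous].
  by rewrite sqrtr0 mulr0 oppr0.
have quad0 : y * (y - 1) @[y --> (0 : R)] --> (0 : R).
  rewrite -[X in _ --> X](mul0r (0 - 1 : R)).
  by apply: cvgM; [exact: cvg_id|apply: cvgB; [exact: cvg_id|exact: cvg_cst]].
apply: squeeze_cvgr sqrt0 quad0; apply: nearW => y.
have [y0|y0] := leP y 0.
  rewrite ln0// mulr0 oppr_le0 mulr_ge0 ?sqrtr_ge0//=.
  by rewrite mulr_le0// subr_le0 (le_trans y0).
rewrite (ler_wpM2l (ltW y0) (ln_le_subr1 y0)) andbT.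
have s0 : 0 < Num.sqrt y by rewrite sqrtr_gt0.
(* The lower bound comes from ln (1 / sqrt y) <= 1 / sqrt y - 1, multiplied by y. *)
have := @ln_le_subr1 _ (Num.sqrt y)^-1; rewrite invr_gt0 lnV ?posrE// => /(_ s0).
have := sqr_sqrtr (ltW y0); set s := Num.sqrt y in s0 * => <-.
move=> /(ler_wpM2l (sqr_ge0 s)).
have -> : s ^+ 2 * (s^-1 - 1) = s - s ^+ 2 by field; rewrite gt_eqF.
by rewrite expr2 lnM ?posrE//; have := sqr_ge0 s; rewrite expr2; lra.
Unshelve. all: by end_near.
Qed.

(** Regrouping into terms x ln x gives continuity even where coordinates tend to 0, although
    [weight] alone may blow up there. *)
Lemma energyE p : energy p =
  (1 - lambda) * (\sum_x margX p x * ln (margX p x))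
  + lambda * (\sum_z p z * ln (p z) - \sum_y margY p y * ln (margY p y))
  + \sum_z p z * (mu * d z - ln (P z.1)).
Proof.
rewrite !margXE !margYE !sum_pushforwardM -sumrB !mulr_sumr -!big_split/=.
by apply: eq_bigr => z _; rewrite /weight !margXE !margYE; ring.
Qed.

Section Limits.
Variables (T : Type) (F : set_system T) (r : T -> X * Y -> R) (p : X * Y -> R).
Hypothesis FF : Filter F.
Hypothesis rp : forall z, r t z @[t --> F] --> p z.

Lemma cvg_energy : energy (r t) @[t --> F] --> energy p.
Proof.
under eq_fun do rewrite energyE.
have mul_ln (f : T -> R) (l : R) : f t @[t --> F] --> l -> f t * ln (f t) @[t --> F] --> l * ln l.
  move=> fl; apply: (@continuous_cvg _ _ _ F FF f (fun x : R => x * ln x)) => //.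
  exact: continuous_mul_ln.
rewrite energyE; apply: cvgD; last first.
  by apply: cvg_sumr => z; apply: cvgM => //; exact: cvg_cst.
apply: cvgD; apply: cvgM; try exact: cvg_cst.
  by apply: cvg_sumr => x; apply: mul_ln; apply: cvg_sumr => y; apply: rp.
apply: cvgB; apply: cvg_sumr => y; first exact: mul_ln.
by apply: mul_ln; apply: cvg_sumr => x; apply: rp.
Qed.

(** Coordinates with [p z = 0] contribute exactly 0; at the others [ln] is continuous. *)
Lemma cvg_rel_entropy : (forall z, 0 <= p z) -> rel_entropy p (r t) @[t --> F] --> (0 : R).
Proof.
move=> p0; rewrite -[X in _ --> X](_ : \sum_z p z * (ln (p z) - ln (p z)) = 0); last first.
  by apply: big1 => z _; rewrite subrr mulr0.
apply: cvg_sumr => z; have [->|pz] := eqVneq (p z) 0.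
  by rewrite mul0r; under eq_fun do rewrite mul0r; exact: cvg_cst.
apply: cvgM; first exact: cvg_cst.
apply: cvgB; first exact: cvg_cst.
by apply: continuous_cvg; [apply: continuous_ln; rewrite lt_def pz p0|exact: rp].
Qed.

End Limits.

(** Compactness gives a cluster point, and a cluster point of an ultrafilter is a limit: the
    preimage of a neighbourhood or its complement lies in the filter. *)
Lemma ultra_cvg_segment (T : Type) (F : set_system T) (FU : UltraFilter F)
    (f : T -> R) (a b : R) :
  (forall t, a <= f t <= b) -> exists l : R, f t @[t --> F] --> l.
Proof.
move=> fab; have FP : ProperFilter (f t @[t --> F]) by apply: fmap_proper_filter.
have [|l [_ clF]] := @segment_compact R a b _ FP.
  by apply: (@filterE T F) => t; rewrite /= in_itv/=; apply: fab.
exists l => A Al; have [//|FnA] := in_ultra_setVsetC (f @^-1` A) FU.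
by have [x [/= nAx Ax]] := clF (~` A) A FnA Al.
Qed.

(** Every iterate keeps the zeros of [r 0], so minimality is stated among laws that vanish there
    too. *)
Lemma iter_step_cvg (r : nat -> X * Y -> R) :
  is_dist (r 0%N) -> (forall t z, r t.+1 z = step (r t) z) ->
  exists p, [/\ is_dist p, forall z, r 0%N z = 0 -> p z = 0,
    forall p', is_dist p' -> (forall z, r 0%N z = 0 -> p' z = 0) ->
      energy p <= energy p' &
    forall z, r t z @[t --> \oo] --> p z].
Proof.
move=> r0d rS0; have rS t : r t.+1 = step (r t) by apply/funext => z.
have rd t : is_dist (r t) by elim: t => // t IH; rewrite rS; apply: step_is_dist.
have supp t z : (r t z == 0) = (r 0%N z == 0).
  by elim: t => // t IH; rewrite rS step_eq0.
have ac p : (forall z, r 0%N z = 0 -> p z = 0) -> forall t z, r t z = 0 -> p z = 0.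
  by move=> pr t z /eqP; rewrite supp => /eqP /pr.
pose lnZ t := - ln (normalizer (r t)).
have lnZ_le_energy t : lnZ t <= energy (r t) by apply: ln_normalizer_le_energy.
have energy_le_lnZ t : energy (r t.+1) <= lnZ t by rewrite rS; apply: energy_step.
have lnZ_decr s t : (s <= t)%N -> lnZ t <= lnZ s.
  move=> /subnK <-; elim: (t - s)%N => // n IH.
  exact: le_trans (le_trans (lnZ_le_energy _) (energy_le_lnZ _)) IH.
have telescope p : is_dist p -> (forall z, r 0%N z = 0 -> p z = 0) -> forall t,
    lnZ t - energy p <= rel_entropy p (r t) - rel_entropy p (r t.+1).
  by move=> pd pr t; rewrite rS; apply: rel_entropy_step => //; apply: ac.
have [U [UU ooU]] := @ultraFilterLemma _ (\oo : set_system nat) _.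
have UP : ProperFilter U := @ultra_proper _ _ UU.
have /choice[p rp] : forall z, exists l : R, r t z @[t --> U] --> l.
  move=> z; apply: (@ultra_cvg_segment _ _ _ _ 0 1) => t.
  have [rt0 rt1] := rd t; rewrite rt0 -rt1 (bigD1 z)//= lerDl.
  by apply: sumr_ge0.
have pd : is_dist p.
  split=> [z|].
    by apply: (cvgr_to_ge (rp z)); apply: nearW => t; apply: (rd t).1.
  have sum_cvg : \sum_z r t z @[t --> U] --> \sum_z p z by apply: cvg_sumr.
  suff one_cvg : \sum_z r t z @[t --> U] --> (1 : R).
    exact: (cvg_unique (@norm_hausdorff _ R) sum_cvg one_cvg).
  rewrite (_ : (fun t => _) = fun=> 1); first exact: cvg_cst.
  by apply/funext => t; apply: (rd t).2.
have pr z : r 0%N z = 0 -> p z = 0.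
  move=> rz; suff zero_cvg : r t z @[t --> U] --> (0 : R).
    exact: (cvg_unique (@norm_hausdorff _ R) (rp z) zero_cvg).
  rewrite (_ : (fun t => _) = fun=> 0); first exact: cvg_cst.
  by apply/funext => t; apply/eqP; rewrite supp rz.
(* For s >= t, [energy (r s.+1) <= lnZ s <= lnZ t]; let s grow along [U]. *)
have energy_p t : energy p <= lnZ t.
  apply: (cvgr_to_le (cvg_energy _ rp)); apply: ooU; exists t.+1 => // -[//|s] /= ts.
  exact: le_trans (energy_le_lnZ s) (lnZ_decr t s ts).
exists p; split=> // [p' p'd p'r|z].
  (* Each of the n telescoped steps lowers the divergence from [p'] by at least
     [energy p - energy p']; a positive gap would contradict the Archimedean property. *)
  have bound n : n%:R * (energy p - energy p') <= rel_entropy p' (r 0%N).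
    suff : n%:R * (energy p - energy p') <= rel_entropy p' (r 0%N) - rel_entropy p' (r n).
      by have := rel_entropy_ge0 p'd (rd n) (ac _ p'r n); lra.
    elim: n => [|n IH]; first by rewrite mul0r subrr.
    by have := telescope _ p'd p'r n; have := energy_p n; rewrite -natr1 mulrDl; lra.
  rewrite leNgt; apply/negP; rewrite -subr_gt0 => e0.
  have D0 := rel_entropy_ge0 p'd (rd 0%N) p'r.
  have := archi_boundP (divr_ge0 D0 (ltW e0)).
  by rewrite ltr_pdivrMr// ltNge bound.
have D_decr s t : (s <= t)%N -> rel_entropy p (r t) <= rel_entropy p (r s).
  move=> /subnK <-; elim: (t - s)%N => // n; apply: le_trans; rewrite addSn.
  by have := telescope _ pd pr (n + s)%N; have := energy_p (n + s)%N; lra.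
apply/cvgrPdist_lt => e e0.
(* One good index suffices, by monotonicity; (e / 2) ^ 2 absorbs the constant 4 of
   [sqr_dist_le_rel_entropy]. *)
have [t Dt] : exists t, rel_entropy p (r t) < (e / 2) ^+ 2.
  apply: (@filter_ex _ U).
  by apply: (cvgr_lt _ (cvg_rel_entropy _ rp pd.1)); rewrite exprn_gt0// divr_gt0.
exists t => // s /= /D_decr Ds.
rewrite -(ltr_pXn2r (n := 2))// ?nnegrE ?ltW// real_normK ?num_real//.
have := sqr_dist_le_rel_entropy z pd (rd s) (ac _ pr s).
by move: Dt; rewrite expr_div_n; lra.
Qed.

End RateDistortion.

(** * Finite and infinite values of extended expectations *)

Section ExtendedExpectation.
Variables (R : realType) (T : finType).
Implicit Types (p r : T -> R) (f : T -> \bar R).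

Lemma expect_EFin p f (g : T -> R) : (forall a, p a != 0 -> f a = (g a)%:E) ->
  expect p f = (\sum_a p a * g a)%:E.
Proof.
move=> fg; rewrite /expect.
under eq_bigr => a pa do rewrite fg// -EFinM.
rewrite sumEFin; congr EFin; rewrite big_mkcond/=; apply: eq_bigr => a _.
by case: eqVneq => // ->; rewrite mul0r.
Qed.

Lemma expect_pinfty p f a : (forall b, 0 <= p b) -> (forall b, f b != -oo%E) ->
  p a != 0 -> f a = +oo%E -> expect p f = +oo%E.
Proof.
move=> p0 fNy pa fa; have pp b : p b != 0 -> 0 < p b by move=> pb; rewrite lt_def pb p0.
rewrite /expect; apply/esum_eqyP => [b /pp pb|].
  by case: (f b) (fNy b) => [s| |]//= _; rewrite gt0_muley.
by exists a; split; rewrite ?mem_index_enum// fa gt0_muley// lte_fin pp.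
Qed.

Lemma KL_EFin p r : (forall a, 0 <= p a) -> (forall a, 0 <= r a) ->
  (forall a, r a = 0 -> p a = 0) -> KL p r = (rel_entropy p r)%:E.
Proof.
move=> p0 r0 rp; rewrite /KL (expect_EFin (g := fun a => ln (p a) - ln (r a)))// => a pa.
have ra : r a != 0 by apply: contra_neq pa => /rp.
by rewrite (negbTE ra) ln_divr// lt_def ?pa ?ra ?p0 ?r0.
Qed.

Lemma KL_pinfty p r a : (forall b, 0 <= p b) -> p a != 0 -> r a = 0 -> KL p r = +oo%E.
Proof.
move=> p0 pa ra; apply: (expect_pinfty p0 _ pa); last by rewrite ra eqxx.
by move=> b; case: ifP.
Qed.

End ExtendedExpectation.

(** * From extended-real definitions to their real counterparts *)

Section Objective.
Variables (R : realType) (X Y : finType) (P : X -> R) (d : X * Y -> R).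
Variables (mu lambda : R).
Hypothesis P_dist : is_dist P.
Implicit Types (q : X * Y -> R) (z : X * Y).

Let w := weight P d mu lambda.

Lemma margX_gt0 q z : is_dist q -> q z != 0 -> 0 < margX q z.1.
Proof.
move=> [q0 _] qz; rewrite margXE; apply: lt_le_trans (le_pushforward fst z q0).
by rewrite lt_def qz q0.
Qed.

Lemma margY_gt0 q z : is_dist q -> q z != 0 -> 0 < margY q z.2.
Proof.
move=> [q0 _] qz; rewrite margYE; apply: lt_le_trans (le_pushforward snd z q0).
by rewrite lt_def qz q0.
Qed.

Lemma omega_EFin q z : is_dist q -> q z != 0 -> P z.1 != 0 ->
  omega P d mu lambda q z = (w q z)%:E.
Proof.
move=> qd qz Pz; rewrite /omega (negbTE Pz); congr EFin.
have Pz0 : 0 < P z.1 by rewrite lt_def Pz P_dist.1.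
have mX := margX_gt0 qd qz; have mY := margY_gt0 qd qz.
have q0 : 0 < q z by rewrite lt_def qz qd.1.
have zE : q (z.1, z.2) = q z by case: (z).
have c0 : 0 < condXY q z.1 z.2 by rewrite /condXY zE divr_gt0.
rewrite ln_divr ?mulr_gt0 ?powR_gt0 ?expR_gt0//.
rewrite !lnM ?posrE ?mulr_gt0 ?powR_gt0 ?expR_gt0// expRK !ln_powR /condXY zE.
by rewrite ln_divr.
Qed.

Lemma omega_neqNy q z : omega P d mu lambda q z != -oo%E.
Proof. by rewrite /omega; case: ifP. Qed.

Lemma objective_EFin q : is_dist q -> (forall z, P z.1 = 0 -> q z = 0) ->
  objective P d mu lambda q = (energy P d mu lambda q)%:E.
Proof.
move=> qd Pq; apply: expect_EFin => z qz; apply: omega_EFin => //.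
by apply: contra_neq qz => /Pq.
Qed.

Lemma objective_pinfty q z : is_dist q -> q z != 0 -> P z.1 = 0 ->
  objective P d mu lambda q = +oo%E.
Proof.
move=> qd qz Pz; apply: (expect_pinfty qd.1 _ qz) => [b|]; first exact: omega_neqNy.
by rewrite /omega Pz eqxx.
Qed.

Lemma mutual_info_EFin q : is_dist q ->
  mutual_info q =
  (\sum_z q z * (ln (q z) - ln (margX q z.1) - ln (margY q z.2)))%:E.
Proof.
move=> qd; apply: expect_EFin => z qz.
have mX := margX_gt0 qd qz; have mY := margY_gt0 qd qz.
have q0 : 0 < q z by rewrite lt_def qz qd.1.
rewrite gt_eqF ?mulr_gt0//; congr EFin.
by rewrite ln_divr ?mulr_gt0// lnM ?posrE// opprD addrA.
Qed.

(** Mutual information and expected distortion are always finite. If [q] charges a zero of [P], the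
    left side and the divergence are both infinite; otherwise the identity is one between real
    sums. *)
Lemma objectiveE q : is_dist q ->
  objective P d mu lambda q =
  (lambda%:E * mutual_info q + KL (margX q) P
   + mu%:E * expect q (fun z => (d z)%:E))%E.
Proof.
move=> qd; rewrite mutual_info_EFin// (expect_EFin (g := d))// -!EFinM.
have [mX0 mX1] : is_dist (margX q) by rewrite margXE; apply: pushforward_is_dist.
have [Pq|/existsNP[z /not_implyP[Pz /eqP qz]]] := pselect (forall z, P z.1 = 0 -> q z = 0).
  have PmX x : P x = 0 -> margX q x = 0.
    by move=> Px; apply: big1 => y _; apply: Pq.
  rewrite objective_EFin// KL_EFin//; last by case: P_dist.
  rewrite -!EFinD; congr EFin.
  rewrite /rel_entropy {2}margXE sum_pushforwardM !mulr_sumr -!big_split/=.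
  by apply: eq_bigr => z _; rewrite /weight; ring.
rewrite (objective_pinfty qd qz Pz) (KL_pinfty (a := z.1))//.
by rewrite gt_eqF// margX_gt0.
Qed.

(** The zeros of [P] are left out because exp(-oo) = 0 there; the initial law does charge them, so
    this can differ from [normalizer] at the first update. *)
Definition restricted_normalizer q : R :=
  \sum_(z | P z.1 != 0) q z * expR (- w q z).

Lemma Lambda_EFin q : is_dist q ->
  Lambda P d mu lambda q = (restricted_normalizer q)%:E.
Proof.
move=> qd; rewrite /Lambda.
rewrite (expect_EFin (g := fun z => if P z.1 == 0 then 0 else expR (- w q z))).
  congr EFin; rewrite /restricted_normalizer [RHS]big_mkcond/=; apply: eq_bigr => z _.
  by case: ifP; rewrite ?mulr0.
move=> z qz; case: ifP => [Pz|/negbT Pz]; last by rewrite omega_EFin.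
by rewrite /omega Pz.
Qed.

Lemma updateE q z : is_dist q ->
  update P d mu lambda q z =
  if P z.1 == 0 then 0 else q z * expR (- w q z) / restricted_normalizer q.
Proof.
move=> qd; rewrite /update Lambda_EFin//=.
case: eqVneq => [->|qz]; first by rewrite !mul0r if_same.
case: ifP => [Pz|/negbT Pz]; first by rewrite /omega Pz/= !mul0r.
by rewrite omega_EFin//= [expR _ * _]mulrC.
Qed.

Lemma update_eq_step q z : is_dist q -> (forall z, P z.1 = 0 -> q z = 0) ->
  update P d mu lambda q z = step P d mu lambda q z.
Proof.
move=> qd Pq; rewrite updateE// /step.
have -> : restricted_normalizer q = normalizer P d mu lambda q.
  rewrite /restricted_normalizer big_mkcond; apply: eq_bigr => a _.
  by case: eqVneq => //= /Pq ->; rewrite mul0r.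
by case: eqVneq => // /Pq ->; rewrite !mul0r.
Qed.

(** * The first update, whose support is exactly {P > 0} *)

Section FirstUpdate.
Variable q : X * Y -> R.
Hypotheses (q_dist : is_dist q) (q_neq0 : forall z, q z != 0) (Y_inhabited : X -> Y).

Lemma restricted_normalizer_gt0 : 0 < restricted_normalizer q.
Proof.
have term_ge0 z : 0 <= q z * expR (- w q z) by rewrite mulr_ge0 ?expR_ge0 ?q_dist.1.
rewrite lt_def sumr_ge0// andbT; apply/eqP => /psumr_eq0P.
move=> /(_ (fun z _ => term_ge0 z)) termz.
(* If all terms vanished, each x with [P x] nonzero would contradict the term at
   [(x, Y_inhabited x)], so [P] would be 0. *)
suff : \sum_x P x = 0 by rewrite P_dist.2; apply/eqP/oner_neq0.
apply: big1 => x _; apply/eqP; apply/negPn/negP => Px.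
have /eqP := termz (x, Y_inhabited x) Px.
by rewrite mulf_eq0 (negbTE (q_neq0 _)) gt_eqF// expR_gt0.
Qed.

Lemma update_eq0 z : (update P d mu lambda q z == 0) = (P z.1 == 0).
Proof.
rewrite updateE//; case: ifP => [_|_]; first exact: eqxx.
rewrite !mulf_eq0 invr_eq0 (negbTE (q_neq0 _)) (gt_eqF (expR_gt0 _)).
by rewrite (gt_eqF restricted_normalizer_gt0).
Qed.

Lemma update_is_dist : is_dist (update P d mu lambda q).
Proof.
have Z0 := restricted_normalizer_gt0; split=> [z|].
  rewrite updateE//; case: ifP => // _.
  by rewrite divr_ge0 ?(ltW Z0)// mulr_ge0 ?expR_ge0 ?q_dist.1.
transitivity (restricted_normalizer q / restricted_normalizer q); last first.
  by rewrite divff// gt_eqF.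
rewrite [X in X / _]/restricted_normalizer mulr_suml [RHS]big_mkcond/=.
by apply: eq_bigr => z _; rewrite updateE//; case: ifP.
Qed.

End FirstUpdate.

End Objective.

Unset Implicit Arguments.
Set Strict Implicit.

Theorem theorem2 (R : realType) (X Y : finType) (P : X -> R) (d : X * Y -> R)
    (mu lambda : R) (q : nat -> X * Y -> R)
    (P_dist : is_dist P)
    (d_ge0 : forall z, 0 <= d z)
    (d_zero : forall x, exists y, d (x, y) = 0)
    (lambda_ge0 : 0 <= lambda) (lambda_le1 : lambda <= 1) (mu_ge0 : 0 <= mu)
    (q1_dist : is_dist (q 1%N))
    (q1_neq0 : forall z, q 1%N z != 0)
    (q_step : forall t z, (1 <= t)%N ->
      q t.+1 z = update P d mu lambda (q t) z) :
  (forall q' : X * Y -> R, is_dist q' ->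
     objective P d mu lambda q' =
     (lambda%:E * mutual_info q' + KL (margX q') P
      + mu%:E * expect q' (fun z => (d z)%:E))%E) /\
  exists qstar : X * Y -> R,
    is_optimal P d mu lambda qstar /\
    forall z, (fun t => q t z) @ \oo --> qstar z.
Proof.
split=> [q' q'd|]; first exact: objectiveE.
(* The zero-distortion choice provides the map from X to Y required by the first update. *)
have [Y0 _] := choice d_zero.
have q2E : q 2%N = update P d mu lambda (q 1%N) by apply/funext => z; apply: q_step.
have q2d : is_dist (q 2%N) by rewrite q2E; apply: update_is_dist.
have q2_eq0 z : (q 2%N z == 0) = (P z.1 == 0) by rewrite q2E; apply: update_eq0.
(* The sequence starts at index 1 and its zeros match those of [P] from index 2 on, hence the shift
   by 2. *)
have qS t : is_dist (q t.+2) /\ (forall z, P z.1 = 0 -> q t.+2 z = 0) ->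
    q t.+3 = step P d mu lambda (q t.+2).
  by move=> [qd Pq]; apply/funext => z; rewrite q_step// update_eq_step.
have q_supp t : is_dist (q t.+2) /\ (forall z, P z.1 = 0 -> q t.+2 z = 0).
  elim: t => [|t IH]; first by split=> // z /eqP; rewrite -q2_eq0 => /eqP.
  rewrite qS//; split=> [|z /IH.2 qz]; first exact: step_is_dist IH.1.
  by rewrite /step qz !mul0r.
have qS' t z : q t.+3 z = step P d mu lambda (q t.+2) z by rewrite qS.
have [p [pd pq p_min qp]] :=
  @iter_step_cvg _ _ _ P d mu lambda lambda_ge0 lambda_le1 (fun t => q t.+2) q2d qS'.
exists p; split; last first.
  by move=> z; rewrite -(cvg_shiftn 2)/=; under eq_fun do rewrite addn2; apply: qp.
have Pp z : P z.1 = 0 -> p z = 0.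
  by move=> /eqP; rewrite -q2_eq0 => /eqP /pq.
split=> // q' q'd; rewrite (objective_EFin d mu lambda P_dist pd Pp).
(* A competitor charging a zero of [P] has infinite objective; any other is covered by [p_min]. *)
have [Pq'|/existsNP[z /not_implyP[Pz /eqP qz]]] := pselect (forall z, P z.1 = 0 -> q' z = 0).
  rewrite (objective_EFin d mu lambda P_dist q'd Pq') lee_fin; apply: p_min => // z /eqP.
  by rewrite q2_eq0 => /eqP /Pq'.
by rewrite (objective_pinfty _ _ _ q'd qz Pz) leey.
Qed.
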